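(* Let $n\in\mathbb{N}$ and $1\le q<\infty$. (i) If $n<p<\infty$, then for any open set $G\subset\mathbb{R}^n$ one has $\operatorname{cap}(G;W_p^1)=0$, and $\operatorname{cap}(G;B_{p,q}^\alpha)=0$ for all $\alpha$ with $n/p<\alpha<1$. (ii) If $p=n\ge2$, then for any bounded open set $G\subset\mathbb{R}^n$ one has $\operatorname{cap}(G;W_n^1)=0$ and $$\lim_{\alpha\to1-0}(1-\alpha)^{n/q}\operatorname{cap}(G;B_{n,q}^\alpha)=0.$$ Thus, in both cases, for any bounded open set $G\subset\mathbb{R}^n$ both sides of the equality $$\lim_{\alpha\to1-0}(1-\alpha)^{p/q}\operatorname{cap}(G;B_{p,q}^\alpha)=\left(\frac1q\right)^{p/q}\operatorname{cap}(G;W_p^1)$$ are equal to zero.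
   Context: Here $\|\cdot\|_p$ is the norm of $L^p(\mathbb{R}^n)$, $e_k$ is the $k$th unit coordinate vector, and $D_kf=\partial f/\partial x_k$. For $f\in L^p(\mathbb{R}^n)$, $1\le p<\infty$, the partial modulus of continuity is $$\omega_k(f;\delta)_p=\sup_{0\le h\le\delta}\left(\int_{\mathbb{R}^n}|f(x+he_k)-f(x)|^p\,dx\right)^{1/p}.$$ For $0<\alpha<1$, $1\le p,q<\infty$, $$\|f\|_{b^\alpha_{p,q;k}}=\left(\int_0^\infty\left(t^{-\alpha}\omega_k(f;t)_p\right)^q\frac{dt}{t}\right)^{1/q},\qquad \|f\|_{b^\alpha_{p,q}}=\sum_{k=1}^n\|f\|_{b^\alpha_{p,q;k}}.$$ For a compact set $K\subset\mathbb{R}^n$, let $\mathfrak{N}(K)$ be the set of all $f\in C_0^\infty(\mathbb{R}^n)$ (smooth, compactly supported) such that $f(x)\ge1$ for all $x\in K$. Define $$\operatorname{cap}(K;W_p^1)=\inf\left\{\left(\sum_{k=1}^n\|D_kf\|_p\right)^p: f\in\mathfrak{N}(K)\right\},\qquad \operatorname{cap}(K;B_{p,q}^\alpha)=\inf\left\{\|f\|_{b^\alpha_{p,q}}^p: f\in\mathfrak{N}(K)\right\}.$$ For an open set $G\subset\mathbb{R}^n$ and $X=W_p^1$ or $X=B_{p,q}^\alpha$, $\operatorname{cap}(G;X)=\sup\{\operatorname{cap}(K;X):K\subset G,\ K\text{ compact}\}$ (possibly $+\infty$). *)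

(* Defs.v *)
From HB Require Import structures.
From mathcomp Require Import all_boot all_order all_algebra.
From mathcomp Require Import all_classical all_reals all_analysis.

Set Implicit Arguments.
Unset Strict Implicit.
Unset Printing Implicit Defensive.

Import Order.TTheory GRing.Theory Num.Theory.
Import numFieldNormedType.Exports.

Local Open Scope classical_set_scope.
Local Open Scope ring_scope.
Local Open Scope ereal_scope.

Section lebesgue_Rn.
Context {R : realType}.
Local Notation Rn n := (n.-tuple (measurableTypeR R)).

Definition consR n (x : measurableTypeR R * Rn n) : Rn n.+1 :=
  [the n.+1.-tuple _ of x.1 :: x.2].

Lemma measurable_consR n : measurable_fun setT (@consR n).
Proof. exact: measurable_cons. Qed.

Section cons_measure.
Variables (n : nat) (mu : {sigma_finite_measure set (Rn n) -> \bar R}).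

Definition cons_measure : set (Rn n.+1) -> \bar R :=
  pushforward (@lebesgue_measure R \x mu) (@consR n).

Let cons_measure0 : cons_measure set0 = 0.
Proof. by rewrite /cons_measure /pushforward preimage_set0 measure0. Qed.

Let cons_measure_ge0 A : 0 <= cons_measure A.
Proof. exact: (@measure_ge0 _ _ _ (@lebesgue_measure R \x mu)). Qed.

Let cons_measure_sigma_additive : semi_sigma_additive cons_measure.
Proof.
move=> F mF tF mUF; rewrite /cons_measure /pushforward preimage_bigcup.
apply: measure_semi_sigma_additive.
- by move=> i; rewrite -[X in measurable X]setTI; apply: measurable_consR.
- apply/trivIsetP => i j _ _ ij; rewrite -preimage_setI.
  by move/trivIsetP : tF => -> //; rewrite preimage_set0.
- rewrite -preimage_bigcup -[X in measurable X]setTI.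
  by apply: measurable_consR.
Qed.

HB.instance Definition _ := isMeasure.Build _ _ _ cons_measure
  cons_measure0 cons_measure_ge0 cons_measure_sigma_additive.

Let cons_measure_sigma_finite : sigma_finite setT cons_measure.
Proof.
have /sigma_finiteP[F [FT ndF mF]] := sigma_finiteT (@lebesgue_measure R).
have /sigma_finiteP[G [GT ndG mG]] := sigma_finiteT mu.
pose g (t : Rn n.+1) : measurableTypeR R * Rn n :=
  (thead t, [tuple of behead t]).
have mg : measurable_fun setT g.
  apply: measurable_fun_pair; first exact: measurable_tnth.
  exact: measurable_behead.
have cg : cancel (@consR n) g.
  by move=> [x t]; rewrite /g theadE; congr pair; exact/val_inj.
exists (fun i => g @^-1` (F i `*` G i)).
  rewrite -preimage_bigcup (_ : \bigcup_i _ = setT) ?preimage_setT//.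
  apply/seteqP; split => // -[x t] _.
  have : [set: measurableTypeR R] x by [].
  have : [set: Rn n] t by [].
  rewrite FT GT => -[j _ Gj] [i _ Fi]; exists (maxn i j) => //; split => /=.
    by move: Fi; exact/subsetPset/ndF/leq_maxl.
  by move: Gj; exact/subsetPset/ndG/leq_maxr.
move=> i; have [mFi Fi] := mF i; have [mGi Gi] := mG i; split.
  by rewrite -[X in measurable X]setTI; apply: mg => //; exact: measurableX.
rewrite /cons_measure /pushforward -comp_preimage.
rewrite (_ : g \o _ = id) ?preimage_id; last exact/funext.
by rewrite product_measure1E// lte_mul_pinfty// ge0_fin_numE.
Qed.

HB.instance Definition _ := Measure_isSigmaFinite.Build _ _ _ cons_measure
  cons_measure_sigma_finite.

End cons_measure.

(* Lebesgue measure of R^n on the product (Borel) sigma-algebra, without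
   completion; every function integrated against it below is continuous. *)
Fixpoint lebesgue_Rn n : {sigma_finite_measure set (Rn n) -> \bar R} :=
  match n with
  | 0 => dirac [tuple]
  | m.+1 => cons_measure (lebesgue_Rn m)
  end.

Lemma lebesgue_Rn_box n (A : 'I_n -> set (measurableTypeR R)) :
  (forall i, measurable (A i)) ->
  lebesgue_Rn n [set t | forall i, A i (tnth t i)] =
  \prod_(i < n) @lebesgue_measure R (A i).
Proof.
elim: n A => [|n IHn] A mA.
  by rewrite big_ord0 /= diracE mem_set//= => -[].
rewrite big_ord_recl -(IHn (fun i => A (lift ord0 i)))//.
have mB : measurable [set t : Rn n | forall i, A (lift ord0 i) (tnth t i)].
  rewrite (_ : [set _ | _] = \bigcap_(i in [set: 'I_n])
     ((fun t : Rn n => tnth t i) @^-1` A (lift ord0 i))).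
    apply: fin_bigcap_measurable; first exact: finite_finset.
    move=> i _; rewrite -[X in measurable X]setTI.
    by apply: measurable_tnth.
  by apply/seteqP; split => t /= h i; [move=> _|]; exact: h.
rewrite -product_measure1E//= /cons_measure /pushforward; congr (_ _).
apply/seteqP; split => -[x t] /=.
  move=> h; split; first exact: (h ord0).
  by move=> i; have := h (lift ord0 i); rewrite tnthS.
move=> [Ax h] i; case: (unliftP ord0 i) => [j|] ->; last exact: Ax.
by rewrite tnthS; exact: h.
Qed.

End lebesgue_Rn.

Section capacities.
Context {R : realType} {n : nat}.
Local Notation E := 'rV[R]_n.
Implicit Types (f : E -> R) (K G : set E) (k : 'I_n) (p q alpha delta : R).

Definition unit_vec k : E := delta_mx ord0 k.

(* Points are row vectors, which carry the topology and the derivatives of the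
   library, while [lebesgue_Rn] lives on tuples; the two are identified
   coordinatewise. *)
Definition rV_of_tuple (t : n.-tuple (measurableTypeR R)) : E :=
  \row_i tnth t i.

Definition Lp_norm p f : \bar R :=
  'N[lebesgue_Rn n]_p%:E[(fun t => (f (rV_of_tuple t))%:E)].

(* [:: k1; ...; km] |-> D_k1 (... (D_km f)) *)
Definition iter_partial (s : seq 'I_n) f : E -> R :=
  foldr (fun k g => 'D_(unit_vec k) g) f s.

Definition smooth f : Prop := forall s : seq 'I_n,
  continuous (iter_partial s f) /\
  forall k x, derivable (iter_partial s f) x (unit_vec k).

Definition compactly_supported f : Prop :=
  compact (closure [set x | f x != 0%R]).

Definition modulus k f delta p : \bar R :=
  ereal_sup [set Lp_norm p (fun x => f (x + h *: unit_vec k) - f x)%R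
            | h in [set h : R | (0 <= h <= delta)%R]].

Definition besov_partial alpha p q k f : \bar R :=
  (\int[@lebesgue_measure R]_(t in `]0%R, +oo[)
     (((t `^ (- alpha))%:E * modulus k f t p) `^ q * (t^-1)%:E)) `^ q^-1.

Definition besov alpha p q f : \bar R :=
  \sum_(k < n) besov_partial alpha p q k f.

Definition admissible K : set (E -> R) :=
  [set f | [/\ smooth f, compactly_supported f
             & forall x, K x -> (1 <= f x)%R]].

Definition capW_compact p K : \bar R :=
  ereal_inf [set (\sum_(k < n) Lp_norm p ('D_(unit_vec k) f)) `^ p
            | f in admissible K].

Definition capB_compact alpha p q K : \bar R :=
  ereal_inf [set besov alpha p q f `^ p | f in admissible K].

Definition cap_open (cap : set E -> \bar R) G : \bar R :=
  ereal_sup [set cap K | K in [set K | compact K /\ K `<=` G]].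

Definition capW p G : \bar R := cap_open (capW_compact p) G.

Definition capB alpha p q G : \bar R := cap_open (capB_compact alpha p q) G.

End capacities.

(* Main.v *)
Require Import Defs.
From mathcomp Require Import all_boot all_order all_algebra.
From mathcomp Require Import all_classical all_reals all_analysis.
From mathcomp Require Import measurable_realfun.
From mathcomp Require Import zify ring lra.
Import Order.TTheory GRing.Theory Num.Theory.
Import numFieldNormedType.Exports.
Local Open Scope classical_set_scope.
Local Open Scope ring_scope.

(** Every capacity involved is squeezed to zero by one explicit family of test
functions.  Let phi be a smooth function on R^n with values in [0, 1], equal to
1 on the unit ball of the sup-norm and to 0 outside the ball of radius 2, and
for l > 0 and N > 0 put
  f(x) = 1/N * sum of phi(x / (l * 8^j)) over j < N.
This function is admissible for every compact subset of the ball of radius l.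
Its j-th term varies only on the shell l 8^j <= |x| <= 2 l 8^j, with slope
O(1 / (N l 8^j)); the thickened shells l 8^j / 2 <= |x| <= 3 l 8^j are still
disjoint, so that for 0 <= h <= l/2 the difference f(x + h e_k) - f(x) is at
most h times a function whose p-th power has integral at most
  sum over j < N of (M / (N l 8^j))^p (6 l 8^j)^n      (its p-th root is [slope_norm]).
The same bound holds for D_k f, by letting h tend to 0, and
|f(x + h e_k) - f(x)| <= 1 with support in two boxes takes care of large h
([size_norm]).  Splitting the Besov integral at a point d <= l/2 then gives
  |f|_{b;k}^q <= A^q d^(q(1-alpha)) / (q(1-alpha)) + B^q d^(-alpha q) / (alpha q)
([besov_partial_le]) with A and B these two constants, hence explicit bounds
for both capacities ([capW_compact_le], [capB_compact_le]).

If p > n, take N = 1 and let l tend to infinity: A is O(l^(n/p - 1)), B is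
O(l^(n/p)), and with d = l/2 the Besov bound is O(l^(n/p - alpha)).  If p = n,
keep l fixed and let N grow: all N terms of the sum are equal, so A^n is
O(N^(1-n)), which tends to 0 because n >= 2; after multiplication by
(1-alpha)^(n/q) the B-term disappears as alpha tends to 1 ([capB_bounded_lim]).

All functions are bounded pointwise by finite combinations of indicators of
boxes, and integrals of nonnegative functions are monotone without any
measurability assumption ([ge0_integral_mono]). *)

(** * Functions with continuous iterated directional derivatives *)

Section Cn.
Context {R : realType} {V : normedModType R} {I : Type}.
Variable e : I -> V.

(** The derivatives of order at most [m] of [f] along the directions [e i] exist
and are continuous.  With [e] the unit vectors for all [m] this gives smoothness
on R^n, and with the single direction 1 it gives smoothness on R, so that the
closure properties below serve both cases. *)
Fixpoint Cn (m : nat) (f : V -> R) : Prop :=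
  continuous f /\
  if m is m'.+1 then
    forall i, (forall x, derivable f x (e i)) /\ Cn m' ('D_(e i) f)
  else True.

Lemma Cn_continuous m f : Cn m f -> continuous f.
Proof. by case: m => [|m] []. Qed.

Lemma CnS m f : Cn m.+1 f -> Cn m f.
Proof.
elim: m f => [|m IH] f [cf] fi; first by [].
by split=> // i; have [df Cf] := fi i; split=> //; exact: IH.
Qed.

Lemma Cn_cst m (c : R) : Cn m (cst c).
Proof.
elim: m c => [|m IH] c; first by split=> //; exact: cst_continuous.
split; first exact: cst_continuous.
move=> i; split=> [x|]; first exact: derivable_cst.
rewrite (_ : 'D_(e i) _ = cst 0) //; apply/funext => x.
exact: derive_cst.
Qed.

Lemma CnD m f g : Cn m f -> Cn m g -> Cn m (f \+ g).
Proof.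
elim: m f g => [|m IH] f g [cf fi] [cg gi].
  by split=> // x; apply: cvgD; [exact: cf|exact: cg].
split; first by move=> x; apply: cvgD; [exact: cf|exact: cg].
move=> i; have [df Cf] := fi i; have [dg Cg] := gi i.
split=> [x|]; first exact: derivableD.
rewrite (_ : 'D_(e i) _ = 'D_(e i) f \+ 'D_(e i) g); first exact: IH.
by apply/funext => x /=; rewrite -deriveD.
Qed.

Lemma CnM m f g : Cn m f -> Cn m g -> Cn m (f \* g).
Proof.
elim: m f g => [|m IH] f g hf hg; have [cf fi] := hf; have [cg gi] := hg.
  by split=> // x; apply: cvgM; [exact: cf|exact: cg].
split; first by move=> x; apply: cvgM; [exact: cf|exact: cg].
move=> i; have [df Cf] := fi i; have [dg Cg] := gi i.
split=> [x|]; first exact: derivableM.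
rewrite (_ : 'D_(e i) _ = (f \* 'D_(e i) g) \+ (g \* 'D_(e i) f)).
  by apply: CnD; apply: IH => //; exact: CnS.
by apply/funext => x /=; exact: deriveM.
Qed.

Lemma Cn_prod m (J : Type) (s : seq J) (F : J -> V -> R) :
  (forall j, Cn m (F j)) -> Cn m (fun x => \prod_(j <- s) F j x).
Proof.
move=> CF; elim: s => [|j s IH].
  by under eq_fun do rewrite big_nil; exact: Cn_cst.
by under eq_fun do rewrite big_cons; exact: CnM.
Qed.

Lemma Cn_sum m (J : Type) (s : seq J) (F : J -> V -> R) :
  (forall j, Cn m (F j)) -> Cn m (fun x => \sum_(j <- s) F j x).
Proof.
move=> CF; elim: s => [|j s IH].
  by under eq_fun do rewrite big_nil; exact: Cn_cst.
by under eq_fun do rewrite big_cons; exact: CnD.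
Qed.

End Cn.

Section comp.
Context {R : realType}.

(** Smooth functions of one real variable. *)
Definition smooth1 (psi : R -> R) := forall m, Cn (fun _ : unit => 1 : R) m psi.

(** A directional derivative is the derivative at 0 of the restriction to a line;
this reduces the chain rule to that of functions of one variable. *)
Lemma is_derive_line {V : normedModType R} (g : V -> R) (x v : V) (d : R) :
  is_derive x v g d <-> is_derive (0 : R) (1 : R) (fun h => g (h *: v + x)) d.
Proof.
have E : 'D_v g x = 'D_1 (fun h : R => g (h *: v + x)) 0.
  rewrite /derive; set g1 := fun h => h^-1 *: _; set g2 := fun h => h^-1 *: _.
  suff -> : g1 = g2 by [].
  by apply/funext => h; rewrite /g1 /g2 /= addr0 scale0r add0r [_%:A]mulr1.
split=> -[dg dE]; apply: DeriveDef.
- exact: (derivable1P g x v).1.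
- by rewrite -E.
- exact: (derivable1P g x v).2.
- by rewrite E.
Qed.

Lemma is_derive_comp_dir {V : normedModType R} (psi : R -> R) (u : V -> R)
  (x v : V) (dpsi du : R) :
  is_derive (u x) 1 psi dpsi -> is_derive x v u du ->
  is_derive x v (psi \o u) (dpsi * du).
Proof.
move=> dp /is_derive_line du'; apply/is_derive_line.
apply: (@is_derive1_comp R psi (fun h => u (h *: v + x)) 0 dpsi du) => //=.
by rewrite scale0r add0r.
Qed.

Lemma Cn_comp {V : normedModType R} {I : Type} (e : I -> V) m
  (psi : R -> R) (u : V -> R) : smooth1 psi -> Cn e m u -> Cn e m (psi \o u).
Proof.
elim: m psi u => [|m IH] psi u sp hu; have [cu ui] := hu.
  by split=> // x; apply: continuous_comp; [exact: cu|exact: (sp 0%N).1].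
have dp x : derivable psi x 1 by exact: ((sp 1%N).2 tt).1.
have D i x : derivable u x (e i) ->
    is_derive x (e i) (psi \o u) (('D_1 psi \o u) x * 'D_(e i) u x).
  move=> du; apply: (is_derive_comp_dir psi u).
    exact: derivableP (dp (u x)).
  exact: derivableP du.
split; first by move=> x; apply: continuous_comp; [exact: cu|exact: (sp 0%N).1].
move=> i; have [du Cu] := ui i; split=> [x|]; first by have [] := D i x (du x).
rewrite (_ : 'D_(e i) _ = ('D_1 psi \o u) \* 'D_(e i) u).
  apply: CnM => //; apply: IH; last exact: CnS.
  by move=> k; exact: ((sp k.+1).2 tt).2.
by apply/funext => x; have [_ ->] := D i x (du x).
Qed.

(** * A smooth plateau on the line *)

(** The function x^-k exp(-1/x), extended by 0 to x <= 0.  The family is stable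
under derivation, which gives the smoothness of exp(-1/x) without polynomials
in 1/x. *)
Definition flat (k : nat) (x : R) : R :=
  if 0 < x then x^-1 ^+ k * expR (- x^-1) else 0.

Lemma exprn_le_expR k (y : R) : 0 <= y -> y ^+ k <= k`!%:R * expR y.
Proof.
move=> y0; case: k => [|k].
  by rewrite expr0 mul1r (le_trans _ (expR_ge1Dx y)) // lerDl.
rewrite [leRHS]mulrC -ler_pdivrMr ?ltr0n ?fact_gt0 //.
by apply: le_trans (expR_ge1Dxn k y0); rewrite lerDr.
Qed.

Lemma flat_ge0 k x : 0 <= flat k x.
Proof.
rewrite /flat; case: ifPn => // x0.
by rewrite mulr_ge0 ?expR_ge0 // exprn_ge0 // invr_ge0 ltW.
Qed.

Lemma flat_le_fact k x : flat k x <= k`!%:R.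
Proof.
rewrite /flat; case: ifPn => // x0.
by rewrite expRN ler_pdivrMr ?expR_gt0 // exprn_le_expR // invr_ge0 ltW.
Qed.

Lemma flatS k x : 0 < x -> flat k x = x * flat k.+1 x.
Proof.
move=> x0; rewrite /flat x0 exprS !mulrA divff ?mul1r //.
by rewrite gt_eqF.
Qed.

Lemma is_derive_flat k x :
  is_derive x (1 : R) (flat k) (- k%:R * flat k.+1 x + flat k.+2 x).
Proof.
have [x0|x0|x0] := ltgtP x 0.
- rewrite {2 3}/flat ltNge (ltW x0) /= mulr0 addr0.
  apply: (@near_eq_is_derive _ _ _ (cst 0) (flat k)).
  near=> y; rewrite /flat ifF //; apply/negbTE; rewrite -leNgt ltW //.
  by near: y; exact: lt_nbhsl.
- apply: (@near_eq_is_derive R R R (fun y : R => y^-1 ^+ k * expR (- y^-1))).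
    by near=> y; rewrite /flat ifT //; near: y; exact: lt_nbhsr.
  have dV : is_derive x (1 : R) (fun y : R => y^-1) (- x ^- 2 *: 1).
    by apply: is_deriveV; rewrite gt_eqF.
  have dX := @is_deriveX R R (fun y : R => y^-1) k x 1 _ dV.
  have dN := @is_deriveN R R R (fun y : R => y^-1) x 1 _ dV.
  have dE := @is_derive1_comp R expR (fun y : R => - y^-1) x _ _
               (is_derive_expR _) dN.
  have D := @is_deriveM R R _ _ x 1 _ _ dX dE.
  set dd := (X in is_derive _ _ _ X) in D.
  have D' : is_derive x (1:R) (fun y : R => y^-1 ^+ k * expR (- y^-1)) dd.
    suff <- : (fun y : R => y^-1) ^+ k * (expR \o (fun y : R => - y^-1)) =
      (fun y : R => y^-1 ^+ k * expR (- y^-1)) by exact: D.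
    by apply/funext => y; rewrite mulrfctE exprfctE.
  apply: (is_derive_eq D').
  rewrite /dd /flat x0 exprfctE /= /GRing.scale /=.
  rewrite -exprVn; set E := expR _; set z := x^-1.
  by case: k {dX D D' dd} => [|k] /=; rewrite ?exprS; ring.
(* At 0, flat k h / h = h * flat k.+2 h for h > 0, and flat k.+2 is bounded. *)
- rewrite x0 {2 3}/flat ltxx mulr0 addr0.
  have cv : h^-1 *: (flat k (h *: 1 + 0) - flat k 0) @[h --> (0:R)^'] --> (0:R).
    apply/cvgr0Pnorm_le => eps eps0; near=> h.
    rewrite addr0 /GRing.scale /= mulr1 {2}/flat ltxx subr0.
    have h0 : h != 0 by near: h; exact: nbhs_dnbhs_neq.
    rewrite normrM (ger0_norm (flat_ge0 k h)).
    have [hp|hn] := ltP 0 h; last first.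
      by rewrite /flat ltNge hn mulr0 ltW.
    rewrite (flatS k) // (flatS k.+1) // gtr0_norm ?invr_gt0 // mulKf //.
    apply: (@le_trans _ _ (h * k.+2`!%:R)).
      by rewrite ler_wpM2l ?flat_le_fact // ltW.
    rewrite -ler_pdivlMr ?ltr0n ?fact_gt0 // -[leLHS](gtr0_norm hp).
    near: h; apply: dnbhs0_le; rewrite divr_gt0 // ltr0n fact_gt0 //.
  split; [exact: cvgP cv|exact: cvg_lim cv].
Unshelve. all: by end_near. Qed.

Lemma flat_smooth k : smooth1 (flat k : R -> R).
Proof.
move=> m; elim: m k => [|m IH] k.
  split=> // x; apply/differentiable_continuous/derivable1_diffP.
  by have [] := is_derive_flat k x.
split; first exact: Cn_continuous (IH k).
move=> []; split=> [x|]; first by have [] := is_derive_flat k x.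
rewrite (_ : 'D_(1 : R) (flat k) = (cst (- k%:R) \* flat k.+1) \+ flat k.+2).
  by apply: CnD => //; apply: CnM => //; exact: Cn_cst.
by apply/funext => x; have [_ ->] := is_derive_flat k x.
Qed.

(** The derivative of [flat 0] is [flat 2], which lies between 0 and 2. *)
Lemma flat0_MVT (x y : R) : x <= y ->
  exists2 c, flat 0 y - flat 0 x = flat 2 c * (y - x) & 0 <= y - x.
Proof.
move=> xy; have [|c _ ->] := @MVT_segment R (flat 0) _ x y xy
    (fun c _ => is_derive_flat 0 c).
  by apply: continuous_subspaceT; have [cf _] := @flat_smooth 0 0%N; exact: cf.
by exists c; rewrite ?subr_ge0 // mulr0n oppr0 mul0r add0r.
Qed.

Lemma flat0_nd (x y : R) : x <= y -> flat 0 x <= flat 0 y.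
Proof.
move=> /flat0_MVT [c E yx].
by rewrite -subr_ge0 E mulr_ge0 // flat_ge0.
Qed.

Lemma flat0_lip (x y : R) : `|flat 0 x - flat 0 y| <= 2 * `|x - y|.
Proof.
wlog xy : x y / x <= y => [H|].
  by have [/H //|/ltW /H] := leP x y; rewrite distrC (distrC y).
have [c E yx] := flat0_MVT _ _ xy.
rewrite distrC E normrM (distrC x) ler_wpM2r // ger0_norm ?flat_ge0 //.
exact: (flat_le_fact 2).
Qed.

Lemma flat0_gt0 (x : R) : 0 < x -> 0 < flat 0 x.
Proof. by move=> x0; rewrite /flat x0 expr0 mul1r expR_gt0. Qed.

(** A smooth step, equal to 1 on y <= 0 and to 0 on y >= 1.  Composing [flat 0]
with [flat 0 1 - flat 0 y] instead of forming the usual quotient of two such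
functions requires no smoothness result on inverses. *)
Definition step (y : R) : R := flat 0 (flat 0 1 - flat 0 y) / flat 0 (flat 0 1).

Let c0 : (0 : R) < flat 0 (flat 0 1).
Proof. by rewrite !flat0_gt0. Qed.

Lemma step_eq1 y : y <= 0 -> step y = 1.
Proof.
move=> y0; rewrite /step.
by have -> : flat 0 y = 0 by [rewrite /flat ltNge y0]; rewrite subr0 divff // gt_eqF.
Qed.

Lemma step_eq0 y : 1 <= y -> step y = 0.
Proof.
move=> y1; rewrite /step.
suff -> : flat 0 (flat 0 1 - flat 0 y) = 0 by rewrite mul0r.
by rewrite {1}/flat ltNge subr_le0 flat0_nd.
Qed.

Lemma step_ge0 y : 0 <= step y.
Proof. by rewrite divr_ge0 ?flat_ge0 // ltW. Qed.

Lemma step_le1 y : step y <= 1.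
Proof.
by rewrite ler_pdivrMr // mul1r flat0_nd // lerBlDr lerDl flat_ge0.
Qed.

Lemma step_lip (x y : R) :
  `|step x - step y| <= 4 / flat 0 (flat 0 1) * `|x - y|.
Proof.
rewrite /step -mulrBl normrM normfV (gtr0_norm c0) [leRHS]mulrAC.
rewrite ler_wpM2r ?invr_ge0 ?(ltW c0) //.
apply: le_trans (flat0_lip _ _) _.
rewrite (_ : _ - _ - _ = - (flat 0 x - flat 0 y)); last by ring.
by rewrite normrN; have := flat0_lip x y; lra.
Qed.

Lemma step_smooth : smooth1 (step : R -> R).
Proof.
move=> m; rewrite (_ : step = (flat 0 \o (cst (flat 0 1) \+ (cst (-1) \* flat 0)))
   \* cst (flat 0 (flat 0 1))^-1).
  apply: CnM; last exact: Cn_cst.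
  apply: Cn_comp; first exact: flat_smooth.
  apply: CnD; first exact: Cn_cst.
  by apply: CnM; [exact: Cn_cst|exact: flat_smooth].
by apply/funext => y /=; rewrite mulN1r.
Qed.

(** A smooth function equal to 1 on [-1, 1] and to 0 outside ]-2, 2[. *)
Definition plateau (y : R) : R := step (y - 1) * step (- y - 1).

Lemma plateau_eq1 y : `|y| <= 1 -> plateau y = 1.
Proof.
rewrite ler_norml => /andP[y1 y2]; rewrite /plateau !step_eq1 ?mulr1 //; lra.
Qed.

Lemma plateau_eq0 y : 2 <= `|y| -> plateau y = 0.
Proof.
rewrite ler_normr /plateau => /orP[y2|y2].
  by rewrite step_eq0 ?mul0r //; lra.
by rewrite (step_eq0 (- y - 1)) ?mulr0 //; lra.
Qed.

Lemma plateau_ge0 y : 0 <= plateau y.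
Proof. by rewrite mulr_ge0 ?step_ge0. Qed.

Lemma plateau_le1 y : plateau y <= 1.
Proof. by rewrite mulr_ile1 ?step_ge0 ?step_le1. Qed.

(** A Lipschitz constant of [plateau]. *)
Definition plateau_lip_cst : R := 8 / flat 0 (flat 0 1).

Lemma plateau_lip_cst_gt0 : 0 < plateau_lip_cst.
Proof. by rewrite divr_gt0. Qed.

Lemma distM_le01 (a b a' b' : R) : 0 <= b <= 1 -> 0 <= a' <= 1 ->
  `|a * b - a' * b'| <= `|a - a'| + `|b - b'|.
Proof.
move=> /andP[b0 b1] /andP[a0 a1].
have -> : a * b - a' * b' = (a - a') * b + a' * (b - b') by ring.
apply: le_trans (ler_normD _ _) _; apply: lerD; rewrite normrM.
  by rewrite (ger0_norm b0) ler_piMr.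
by rewrite (ger0_norm a0) ler_piMl.
Qed.

Lemma plateau_lip (x y : R) :
  `|plateau x - plateau y| <= plateau_lip_cst * `|x - y|.
Proof.
apply: le_trans (distM_le01 _ _ _ _ _ _) _; rewrite ?step_ge0 ?step_le1 //.
have -> : plateau_lip_cst = 4 / flat 0 (flat 0 1) + 4 / flat 0 (flat 0 1).
  by rewrite /plateau_lip_cst -mulrDl -natrD.
rewrite [leRHS]mulrDl; apply: lerD.
  have -> : x - y = x - 1 - (y - 1) by ring.
  exact: step_lip.
have -> : `|x - y| = `|(- x - 1) - (- y - 1)| by rewrite distrC; congr `|_|; ring.
exact: step_lip.
Qed.

Lemma is_derive_affine (a b x : R) : is_derive x (1 : R) (fun y : R => a * y + b) a.
Proof.
have D := @is_deriveD R R R _ _ x 1 _ _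
  (@is_deriveZ R R R _ a x 1 _ (is_derive_id x (1:R))) (is_derive_cst b x (1 : R)).
by apply: (is_derive_eq D); rewrite addr0 [_ *: _]mulr1.
Qed.

Lemma affine_smooth (a b : R) : smooth1 (fun y : R => a * y + b).
Proof.
have is_d := is_derive_affine a b.
have c (x : R) : {for x, continuous (fun y : R => a * y + b)}.
  by apply/differentiable_continuous/derivable1_diffP; have [] := is_d x.
case=> [|m]; first by split.
split=> // _; split=> [x|]; first by have [] := is_d x.
rewrite (_ : 'D_(1 : R) (fun y : R => a * y + b) = cst a); first exact: Cn_cst.
by apply/funext => x; have [_ ->] := is_d x.
Qed.

Lemma plateau_smooth : smooth1 (plateau : R -> R).
Proof.
move=> m; rewrite (_ : plateau = (step \o (fun y => 1 * y + (- 1)))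
   \* (step \o (fun y => (- 1) * y + (- 1)))).
  by apply: CnM; (apply: Cn_comp; [exact: step_smooth|exact: affine_smooth]).
by apply/funext => y /=; rewrite mul1r mulN1r.
Qed.

End comp.

(** * Norms of functions dominated by indicators of boxes *)

(** Measurability is not needed: the integral of a nonnegative function is a
supremum over the simple functions below it. *)
Lemma ge0_integral_mono {d} {T : measurableType d} {R : realType}
    (mu : {measure set T -> \bar R}) (D : set T) (f g : T -> \bar R) :
  (forall x, D x -> (0 <= f x)%E) -> (forall x, D x -> (f x <= g x)%E) ->
  (\int[mu]_(x in D) f x <= \int[mu]_(x in D) g x)%E.
Proof.
move=> f0 fg; rewrite !ge0_integralE //; last first.
  by move=> x Dx; exact: le_trans (f0 x Dx) (fg x Dx).
apply: le_ereal_sup => _ /= [h hf <-]; exists h => // x.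
apply: le_trans (hf x) _; rewrite /patch; case: ifPn => // /[!inE] Dx.
exact: fg.
Qed.

Lemma ge0_le_poweR {R : realType} (r : R) (x y : \bar R) : 0 <= r ->
  (0 <= x)%E -> (x <= y)%E -> (x `^ r <= y `^ r)%E.
Proof.
move=> r0 x0 xy; apply: gt0_ler_poweR => //.
  by rewrite in_itv /= x0 leey.
by rewrite in_itv /= leey andbT (le_trans x0).
Qed.

Section Lp.
Context {R : realType} {n : nat}.
Local Notation E := 'rV[R]_n.

Lemma rV_norm_le (x : E) (r : R) : 0 <= r ->
  (`|x| <= r) <-> (forall i, `|x ord0 i| <= r).
Proof.
move=> r0; rewrite [`|x|]/Num.norm /= mx_normrE; split=> [/bigmax_leP[_ H] i|H].
  exact: (H (ord0, i)).
by apply/bigmax_leP; split=> // -[i j] _ /=; rewrite (ord1 i).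
Qed.

(** The sup-norm ball of center [- a] and radius [r], as a set of tuples. *)
Definition tbox (a : E) (r : R) : set (n.-tuple (measurableTypeR R)) :=
  [set t | `|rV_of_tuple t + a| <= r].

Lemma tboxE a r : 0 <= r -> tbox a r =
  [set t | forall i, `[- a ord0 i - r, r - a ord0 i]%classic (tnth t i)].
Proof.
move=> r0; apply/seteqP; split=> t /=.
  move/(rV_norm_le _ _ r0) => H i; have := H i.
  by rewrite !mxE in_itv /= ler_norml => /andP[? ?]; apply/andP; split; lra.
move=> H; apply/(rV_norm_le _ _ r0) => i; have := H i.
by rewrite !mxE in_itv /= ler_norml => /andP[? ?]; apply/andP; split; lra.
Qed.

Lemma measurable_tbox a r : 0 <= r -> measurable (tbox a r).
Proof.
move=> r0; rewrite tboxE // (_ : [set _ | _] = \bigcap_(i in [set: 'I_n])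
   ((fun t : n.-tuple (measurableTypeR R) => tnth t i) @^-1`
     `[- a ord0 i - r, r - a ord0 i]%classic)).
  apply: fin_bigcap_measurable; first exact: finite_finset.
  move=> i _; rewrite -[X in measurable X]setTI.
  by apply: measurable_tnth => //; exact: measurable_itv.
by apply/seteqP; split => t /= h i; [move=> _|]; exact: h.
Qed.

Lemma lebesgue_tbox a r : 0 <= r ->
  lebesgue_Rn n (tbox a r) = ((2 * r) ^+ n)%:E.
Proof.
move=> r0; rewrite tboxE //.
rewrite (@lebesgue_Rn_box R n
  (fun i => `[- a ord0 i - r, r - a ord0 i]%classic)); last first.
  by move=> i; exact: measurable_itv.
rewrite (eq_bigr (fun=> (2 * r)%:E)); last first.
  move=> i _; rewrite lebesgue_measure_itv /= lte_fin.
  case: ltP => h; first by rewrite -EFinD; congr _%:E; ring.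
  by congr _%:E; lra.
by rewrite prodEFin prodr_const card_ord.
Qed.

Lemma Lp_norm_le_boxes (p : R) (f : E -> R) (N : nat) (c r : 'I_N -> R)
    (a : 'I_N -> E) : 0 < p -> (forall j, 0 <= c j) -> (forall j, 0 <= r j) ->
  (forall x, `|f x| `^ p <= \sum_j c j * (`|x + a j| <= r j)%R%:R) ->
  (Lp_norm p f <= ((\sum_j c j * (2 * r j) ^+ n) `^ p^-1)%:E)%E.
Proof.
move=> p0 c0 r0 H.
rewrite /Lp_norm unlock /Lnorm -poweR_EFin.
apply: ge0_le_poweR; first by rewrite invr_ge0 ltW.
  by apply: integral_ge0 => t _; exact: poweR_ge0.
pose g (j : 'I_N) (t : n.-tuple (measurableTypeR R)) : \bar R :=
  ((c j)%:E * (\1_(tbox (a j) (r j)) t)%:E)%E.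
have mI j : measurable_fun setT
    (EFin \o (\1_(tbox (a j) (r j)) : _ -> R)).
  by apply/measurable_EFinP; apply: measurable_indic; exact: measurable_tbox.
apply: (@le_trans _ _ (\int[lebesgue_Rn n]_t \sum_(j < N) g j t)%E).
  apply: ge0_integral_mono => t _; first exact: poweR_ge0.
  rewrite /g.
  under eq_bigr do rewrite -EFinM.
  rewrite sumEFin lee_fin; apply: le_trans (H _) _; apply: ler_sum => j _.
  rewrite ler_wpM2l // indicE.
  rewrite (_ : (t \in _) = (`|rV_of_tuple t + a j| <= r j)) //.
  by apply/idP/idP; rewrite inE.
rewrite ge0_integral_sum //; last 2 first.
- by move=> j; apply: measurable_funeM; exact: mI.
- by move=> j t _; rewrite /g mule_ge0 // lee_fin.
rewrite -sumEFin; apply: lee_sum => j _.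
rewrite ge0_integralZl_EFin //; last exact: mI.
rewrite integral_indic ?setIT //; last exact: measurable_tbox.
by rewrite EFinM -(lebesgue_tbox (a j) (r j) (r0 j)) lexx.
Qed.
End Lp.

(** * The Besov seminorm of a function with a given modulus of continuity *)

Section besov_estimate.
Context {R : realType}.
Local Notation mu := (@lebesgue_measure R).

Lemma continuous_powR (r x : R) : 0 < x -> {for x, continuous (@powR R ^~ r)}.
Proof.
move=> x0; apply/differentiable_continuous/derivable1_diffP.
by apply: derivable_powR; rewrite in_itv /= x0.
Qed.

Lemma integral_powR (a b r : R) : 0 < a -> a < b -> r != 0 ->
  (\int[mu]_(x in `[a, b]) (x `^ (r - 1))%:E = ((b `^ r - a `^ r) / r)%:E)%E.
Proof.
move=> a0 ab r0.
have b0 : 0 < b by exact: lt_trans ab.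
pose F := (fun x : R => r^-1 * x `^ r).
have dF (x : R) : 0 < x -> is_derive x (1 : R) F (x `^ (r - 1)).
  move=> x0; have D := @is_deriveZ R R R (@powR R ^~ r) r^-1 x 1 _
    (is_derive1_powR r x0).
  by apply: (is_derive_eq D); rewrite /GRing.scale /= mulrA mulVf // mul1r.
have cF (x : R) : 0 < x -> {for x, continuous F}.
  by move=> x0; apply/differentiable_continuous/derivable1_diffP; have [] := dF x x0.
rewrite (@continuous_FTC2 R (fun x => x `^ (r - 1)) F) //.
- by rewrite -EFinB /F -mulrBr mulrC.
- apply: continuous_in_subspaceT => x; rewrite inE /= in_itv /= => /andP[ax _].
  by apply: continuous_powR; exact: lt_le_trans ax.
- split.
  + move=> x; rewrite in_itv /= => /andP[ax _].
    by have [] := dF x (lt_trans a0 ax).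
  + by apply: cvg_at_right_filter; exact: cF.
  + by apply: cvg_at_left_filter; exact: cF.
- move=> x; rewrite in_itv /= => /andP[ax _].
  by rewrite derive1E; have [_ ->] := dF x (lt_trans a0 ax).
Qed.

(** A bound on the integrals over an increasing sequence of sets passes to their
union; it turns the proper integral [integral_powR] into bounds of the two
improper ones. *)
Lemma integral_bigcup_le (F : (set (measurableTypeR R))^nat)
    (f : measurableTypeR R -> R) (C : R) :
  nondecreasing_seq F -> (forall i, measurable (F i)) ->
  measurable_fun setT f -> (forall x, 0 <= f x) ->
  (forall i, (\int[mu]_(x in F i) (f x)%:E <= C%:E)%E) ->
  (\int[mu]_(x in \bigcup_i F i) (f x)%:E <= C%:E)%E.
Proof.
move=> ndF mF mf f0 H.
have cv := @ge0_nondecreasing_set_cvg_integral _ (measurableTypeR R) R F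
  (EFin \o f) mu ndF mF.
have {}cv := cv (fun i => measurable_funTS ((measurable_EFinP _ _).2 mf)).
have {}cv := cv (fun i x _ => f0 x).
rewrite -(cvg_lim _ cv) //; apply: lime_le; first exact: cvgP cv.
by apply: nearW => i; exact: H.
Qed.

Lemma integral_powR_near0 (d s : R) : 0 < d -> 0 < s ->
  (\int[mu]_(x in `]0%R, d]) (x `^ (s - 1))%:E <= (d `^ s / s)%:E)%E.
Proof.
move=> d0 s0.
pose F (i : nat) : set (measurableTypeR R) := `[d / i.+2%:R, d]%classic.
have -> : (`]0, d]%classic : set R) = \bigcup_i F i.
  apply/seteqP; split=> x /=.
    rewrite in_itv /= => /andP[x0 xd].
    exists (Num.truncn (d / x)) => //; rewrite /F /= in_itv /= xd andbT.
    rewrite ler_pdivrMr ?ltr0n // mulrC -ler_pdivrMr // ltW //.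
    by apply: (lt_le_trans (truncnS_gt _)); rewrite ler_nat.
  move=> [i _]; rewrite /F /= !in_itv /= => /andP[dx ->]; rewrite andbT.
  by apply: lt_le_trans dx; rewrite divr_gt0 // ltr0n.
apply: integral_bigcup_le.
- apply/nondecreasing_seqP => i; apply/subsetPset => x; rewrite /F /= !in_itv /=.
  move=> /andP[dx ->]; rewrite andbT; apply: le_trans dx.
  by rewrite ler_pM2l // lef_pV2 ?posrE ?ltr0n // ler_nat.
- by move=> i; exact: measurable_itv.
- exact: measurable_powR.
- by move=> x; exact: powR_ge0.
move=> i; rewrite integral_powR ?divr_gt0 ?ltr0n ?gt_eqF //; last first.
  by rewrite ltr_pdivrMr ?ltr0n // ltr_pMr // ltr1n.
by rewrite lee_fin ler_pM2r ?invr_gt0 // gerBl powR_ge0.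
Qed.

Lemma integral_powR_at_infty (d s : R) : 0 < d -> 0 < s ->
  (\int[mu]_(x in `]d, +oo[) (x `^ (- s - 1))%:E <= (d `^ (- s) / s)%:E)%E.
Proof.
move=> d0 s0.
pose F (i : nat) : set (measurableTypeR R) := `[d, d + i.+1%:R]%classic.
apply: (@le_trans _ _ (\int[mu]_(x in \bigcup_i F i) (x `^ (- s - 1))%:E)%E).
  apply: ge0_subset_integral => //.
  - apply: bigcup_measurable => i _; exact: measurable_itv.
  - by apply/measurable_EFinP; apply: measurable_funTS; exact: measurable_powR.
  - by move=> x _; rewrite lee_fin powR_ge0.
  move=> x /=; rewrite in_itv /= andbT => dx.
  exists (Num.truncn (x - d)) => //; rewrite /F /= in_itv /= ltW //=.
  by rewrite -lerBlDl ltW // truncnS_gt.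
apply: integral_bigcup_le.
- apply/nondecreasing_seqP => i; apply/subsetPset => x; rewrite /F /= !in_itv /=.
  by move=> /andP[-> dx] /=; apply: le_trans dx _; rewrite lerD2l ler_nat.
- by move=> i; exact: measurable_itv.
- exact: measurable_powR.
- by move=> x; exact: powR_ge0.
move=> i; rewrite integral_powR ?oppr_eq0 ?gt_eqF ?ltrDl ?ltr0n //.
rewrite lee_fin invrN mulrN -mulNr ler_pM2r ?invr_gt0 // opprB gerBl.
exact: powR_ge0.
Qed.

End besov_estimate.

Section besov_estimate2.
Context {R : realType} {n : nat}.
Local Notation mu := (@lebesgue_measure R).
Implicit Types (f : 'rV[R]_n -> R) (k : 'I_n).

Lemma modulus_ge0 k f (t p : R) : 0 <= t -> (0 <= modulus k f t p)%E.
Proof.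
move=> t0.
apply: (@le_trans _ _ (Lp_norm p (fun x => f (x + 0 *: unit_vec k) - f x)%R)).
  exact: Lnorm_ge0.
by apply: ereal_sup_ubound; exists 0 => //=; rewrite lexx.
Qed.

Lemma modulus_le k f (t p C : R) :
  (forall h, 0 <= h <= t ->
    (Lp_norm p (fun x => f (x + h *: unit_vec k) - f x)%R <= C%:E)%E) ->
  (modulus k f t p <= C%:E)%E.
Proof. by move=> H; apply: ge_ereal_sup => _ [h /= ht <-]; exact: H. Qed.

Lemma powR_small (alpha q A t : R) : 0 <= A -> 0 < t ->
  (t `^ (- alpha) * (A * t)) `^ q * t^-1 = A `^ q * t `^ (q * (1 - alpha) - 1).
Proof.
move=> A0 t0; have tn0 : t != 0 by rewrite gt_eqF.
have t00 := ltW t0.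
rewrite mulrCA powRM ?mulr_ge0 ?powR_ge0 //.
rewrite -mulrA; congr (_ * _).
rewrite -[X in (_ * X) `^ _](powRr1 t00) -[t^-1]powR_inv1 //.
rewrite -powRD ?tn0 ?implybT // -powRrM -powRD ?tn0 ?implybT //.
by congr (_ `^ _); ring.
Qed.

Lemma powR_large (alpha q B t : R) : 0 <= B -> 0 < t ->
  (t `^ (- alpha) * B) `^ q * t^-1 = B `^ q * t `^ (- (alpha * q) - 1).
Proof.
move=> B0 t0; have tn0 : t != 0 by rewrite gt_eqF.
have t00 := ltW t0.
rewrite powRM ?powR_ge0 // mulrAC [RHS]mulrC; congr (_ * _).
rewrite -[t^-1]powR_inv1 // -powRrM -powRD ?tn0 ?implybT //.
by congr (_ `^ _); ring.
Qed.

Lemma besov_integrand_le (t c q : R) (m : \bar R) (b : R) : 0 < t -> 0 <= c ->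
  0 < q -> (0 <= m)%E -> (m <= b%:E)%E ->
  ((c%:E * m) `^ q * (t^-1)%:E <= ((c * b) `^ q * t^-1)%:E)%E.
Proof.
move=> t0 c0 q0 m0 mb.
rewrite EFinM lee_wpmul2r // ?lee_fin ?invr_ge0 ?(ltW t0) //.
rewrite -poweR_EFin; apply: ge0_le_poweR; first exact: ltW.
  by rewrite mule_ge0.
by rewrite EFinM lee_wpmul2l.
Qed.

(** If the modulus of continuity is at most [A * t] up to [d] and at most [B]
beyond, the integral defining the seminorm is split at [d]. *)
Lemma besov_partial_le (alpha p q A B d : R) k f :
  0 < alpha < 1 -> 0 < q -> 0 <= A -> 0 <= B -> 0 < d ->
  (forall t, 0 < t <= d -> (modulus k f t p <= (A * t)%:E)%E) ->
  (forall t, d < t -> (modulus k f t p <= B%:E)%E) ->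
  (besov_partial alpha p q k f <=
    ((A `^ q * (d `^ (q * (1 - alpha)) / (q * (1 - alpha))) +
      B `^ q * (d `^ (- (alpha * q)) / (alpha * q))) `^ q^-1)%:E)%E.
Proof.
move=> /andP[al0 al1] q0 A0 B0 d0 HA HB.
pose G1 (t : measurableTypeR R) := A `^ q * t `^ (q * (1 - alpha) - 1).
pose G2 (t : measurableTypeR R) := B `^ q * t `^ (- (alpha * q) - 1).
pose G t := if t <= d then G1 t else G2 t.
have G10 t : 0 <= G1 t by rewrite mulr_ge0 ?powR_ge0.
have G20 t : 0 <= G2 t by rewrite mulr_ge0 ?powR_ge0.
have mG1 : measurable_fun setT G1.
  by apply: measurable_funM => //; exact: measurable_powR.
have mG2 : measurable_fun setT G2.
  by apply: measurable_funM => //; exact: measurable_powR.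
have mG : measurable_fun setT (EFin \o G).
  apply/measurable_EFinP; apply: measurable_fun_ifT => //.
  exact: measurable_fun_ler.
have s10 : 0 < q * (1 - alpha) by rewrite mulr_gt0 // subr_gt0.
have s20 : 0 < alpha * q by rewrite mulr_gt0.
rewrite /besov_partial -poweR_EFin; apply: ge0_le_poweR.
- by rewrite invr_ge0 ltW.
- apply: integral_ge0 => t; rewrite /= in_itv /= andbT => t0.
  by rewrite mule_ge0 ?poweR_ge0 // lee_fin invr_ge0 ltW.
apply: (@le_trans _ _ (\int[mu]_(t in `]0%R, +oo[) (EFin \o G) t)%E).
  apply: ge0_integral_mono => t; rewrite /= in_itv /= andbT => t0.
    by rewrite mule_ge0 ?poweR_ge0 // lee_fin invr_ge0 ltW.
  have m0 := @modulus_ge0 k f t p (ltW t0).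
  rewrite [leRHS]/= /G; case: ifPn => [td|]; [|rewrite -ltNge => td].
  - rewrite /G1 -powR_small //; apply: besov_integrand_le; rewrite ?powR_ge0 //.
    by apply: HA; rewrite t0.
  - rewrite /G2 -powR_large //; apply: besov_integrand_le; rewrite ?powR_ge0 //.
    exact: HB.
have -> : (`]0, +oo[%classic : set (measurableTypeR R)) =
    `]0, d]%classic `|` `]d, +oo[%classic.
  apply/seteqP; split=> x /=; rewrite !in_itv /= !andbT.
    by move=> x0; case: (leP x d) => xd; [left; rewrite x0|right].
  by move=> [/andP[]//|]; exact: lt_trans.
rewrite ge0_integral_setU //; last 3 first.
- exact: measurable_funTS.
- by move=> x _; rewrite /= lee_fin /G; case: ifP.
- apply/disj_setPS => x /=; rewrite !in_itv /= andbT => -[/andP[_ xd] dx].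
  by have := lt_le_trans dx xd; rewrite ltxx.
rewrite EFinD leeD //.
- rewrite (@eq_integral _ _ _ mu _
    (fun t => (A `^ q)%:E * (t `^ (q * (1 - alpha) - 1))%:E)%E); last first.
    by move=> x; rewrite inE /= in_itv /= => /andP[_ xd]; rewrite /G xd EFinM.
  rewrite ge0_integralZl_EFin ?powR_ge0 //; last 2 first.
  + by move=> x _; rewrite lee_fin powR_ge0.
  + by apply/measurable_EFinP; apply: measurable_funTS; exact: measurable_powR.
  by rewrite EFinM lee_wpmul2l ?lee_fin ?powR_ge0 //; exact: integral_powR_near0.
- rewrite (@eq_integral _ _ _ mu _
    (fun t => (B `^ q)%:E * (t `^ (- (alpha * q) - 1))%:E)%E); last first.
    by move=> x; rewrite inE /= in_itv /= andbT => xd; rewrite /G leNgt xd EFinM.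
  rewrite ge0_integralZl_EFin ?powR_ge0 //; last 2 first.
  + by move=> x _; rewrite lee_fin powR_ge0.
  + by apply/measurable_EFinP; apply: measurable_funTS; exact: measurable_powR.
  by rewrite EFinM lee_wpmul2l ?lee_fin ?powR_ge0 //; exact: integral_powR_at_infty.
Qed.

End besov_estimate2.

(** * Averaged plateaux on R^n *)

Section bump.
Context {R : realType} {n : nat}.
Local Notation E := 'rV[R]_n.
Local Notation Csm := (Cn (@unit_vec R n)).
Implicit Types (x : E) (k i : 'I_n) (l : R) (N : nat).

Lemma smooth_Cn (f : E -> R) : (forall m, Csm m f) -> smooth f.
Proof.
move=> Cf s; have Cs m : Csm m (iter_partial s f).
  elim: s m => [|k s IH] m //=; exact: ((IH m.+1).2 k).2.
split; first exact: Cn_continuous (Cs 0%N).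
by move=> k; exact: ((Cs 1%N).2 k).1.
Qed.

Lemma Cn_coord m i : Csm m (fun x : E => x ord0 i).
Proof.
have c : continuous (fun x : E => x ord0 i) by exact: coord_continuous.
have is_d x k : is_derive x (unit_vec k) (fun x : E => x ord0 i)
    (unit_vec k ord0 i : R).
  apply/(@is_derive_line R E).
  rewrite (_ : (fun h : R => _) = (fun h : R => unit_vec k ord0 i * h + x ord0 i)).
    exact: is_derive_affine.
  by apply/funext => h; rewrite !mxE mulrC.
case: m => [|m]; split=> // k; split=> [x|]; first by have [] := is_d x k.
rewrite (_ : 'D__ _ = cst (unit_vec k ord0 i : R)); first exact: Cn_cst.
by apply/funext => x; have [_ ->] := is_d x k.
Qed.

(** A smooth function equal to 1 on the sup-norm ball of radius [l] and to 0
outside the ball of radius [2 * l]. *)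
Definition bump l x : R := \prod_(i < n) plateau (l^-1 * x ord0 i).

Lemma bump_Cn m l : Csm m (bump l).
Proof.
apply: (@Cn_prod R E _ (@unit_vec R n)) => i.
apply: (@Cn_comp R E _ (@unit_vec R n) m plateau (fun x => l^-1 * x ord0 i)).
  exact: plateau_smooth.
by apply: (@CnM R E _ _ m (cst l^-1)); [exact: Cn_cst|exact: Cn_coord].
Qed.

Lemma bump_ge0 l x : 0 <= bump l x.
Proof. by apply: prodr_ge0 => i _; exact: plateau_ge0. Qed.

Lemma bump_le1 l x : bump l x <= 1.
Proof. by apply: prodr_ile1 => i _; rewrite plateau_ge0 plateau_le1. Qed.

Lemma bump_eq1 l x : 0 < l -> `|x| <= l -> bump l x = 1.
Proof.
move=> l0 /(rV_norm_le _ _ (ltW l0)) xl; apply: big1 => i _.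
apply: plateau_eq1; rewrite normrM gtr0_norm ?invr_gt0 //.
by rewrite mulrC ler_pdivrMr // mul1r.
Qed.

Lemma bump_eq0 l x : 0 < l -> 2 * l < `|x| -> bump l x = 0.
Proof.
move=> l0; rewrite ltNge => /negP xl; apply/eqP/negPn/negP => b0; apply: xl.
apply/rV_norm_le; first by rewrite mulr_ge0 // ltW.
move=> i; rewrite leNgt; apply/negP => xi; move/eqP: b0; apply.
rewrite /bump (bigD1 i) //= plateau_eq0 ?mul0r //.
by rewrite normrM gtr0_norm ?invr_gt0 // mulrC ler_pdivlMr // ltW.
Qed.

Lemma bump_lip l x h k : 0 < l -> 0 <= h ->
  `|bump l (x + h *: unit_vec k) - bump l x| <= h * (plateau_lip_cst / l).
Proof.
move=> l0 h0; rewrite /bump (bigD1 k) //= [X in _ - X](bigD1 k) //=.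
rewrite (eq_bigr (fun i => plateau (l^-1 * x ord0 i))); last first.
  by move=> i ik; rewrite !mxE eqxx (negbTE ik) mulr0 addr0.
rewrite -mulrBl normrM.
set P := \prod_(i < n | _) _.
have P01 : `|P| <= 1.
  rewrite ger0_norm; last by apply: prodr_ge0 => i _; exact: plateau_ge0.
  by apply: prodr_ile1 => i _; rewrite plateau_ge0 plateau_le1.
apply: le_trans (ler_piMr (normr_ge0 _) P01) _.
apply: le_trans (plateau_lip _ _) _.
rewrite -mulrBr normrM gtr0_norm ?invr_gt0 // !mxE !eqxx mulr1.
rewrite [x _ _ + _]addrC addrK ger0_norm // mulrA.
by rewrite mulrC.
Qed.

Lemma norm_scale_unit_vec h k : 0 <= h -> `|h *: unit_vec k : E| <= h.
Proof.
move=> h0; apply/rV_norm_le => // i; rewrite !mxE eqxx /=.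
case: eqP => _; rewrite ?mulr1 ?mulr0 ?normr0 // ger0_norm //.
Qed.

(** The bump [bump l] is constant inside and outside of l <= |x| <= 2 l; this
thickened shell contains all points at distance at most [l / 2] from it. *)
Definition shell l x : bool := (l / 2 <= `|x|) && (`|x| <= 3 * l).

Lemma bump_diff l x h k : 0 < l -> 0 <= h <= l / 2 ->
  `|bump l (x + h *: unit_vec k) - bump l x| <=
    h * (plateau_lip_cst / l) * (shell l x)%:R.
Proof.
move=> l0 /andP[h0 hl].
have [sh|] := boolP (shell l x); first by rewrite mulr1; exact: bump_lip.
have eh := norm_scale_unit_vec h k h0.
have xe := ler_normD x (h *: unit_vec k).
have ex := ler_normB (x + h *: unit_vec k) (h *: unit_vec k : E).
rewrite addrK in ex.
rewrite negb_and -!ltNge mulr0 => /orP[xl|xl].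
  have x1 : `|x| <= l by lra.
  have x2 : `|x + h *: unit_vec k| <= l by lra.
  by rewrite !bump_eq1 // subrr normr0.
have x1 : 2 * l < `|x| by lra.
have x2 : 2 * l < `|x + h *: unit_vec k| by lra.
by rewrite !bump_eq0 // subrr normr0.
Qed.

(** The ratio 8 exceeds the ratio 6 of the radii of [shell], which makes the
shells of different scales disjoint. *)
Definition scale l (j : nat) : R := l * 8 ^+ j.

Lemma scale_gt0 l j : 0 < l -> 0 < scale l j.
Proof. by move=> l0; rewrite mulr_gt0 // exprn_gt0. Qed.

Lemma scale_ge l j : 0 < l -> l <= scale l j.
Proof. by move=> l0; rewrite /scale ler_peMr ?(ltW l0) // exprn_ege1 // ler1n. Qed.

Lemma shell_disjoint l x (i j : nat) : 0 < l -> (i < j)%N ->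
  shell (scale l i) x -> shell (scale l j) x -> False.
Proof.
move=> l0 ij /andP[_ xi] /andP[xj _].
have : scale l i * 8 <= scale l j.
  by rewrite /scale -mulrA -exprSr ler_pM2l // ler_eXn2l // ltr1n.
by have := scale_gt0 l i l0; lra.
Qed.

(** The test function: an average of [N] plateaux at geometric scales. *)
Definition mean_bump l N x : R := N%:R^-1 * \sum_(j < N) bump (scale l j) x.

Lemma mean_bump_smooth l N : smooth (mean_bump l N).
Proof.
apply: smooth_Cn => m.
apply: (@CnM R E _ _ m (cst N%:R^-1)); first exact: Cn_cst.
by apply: (@Cn_sum R E _ (@unit_vec R n)) => j; exact: bump_Cn.
Qed.

Lemma mean_bump_ge0 l N x : 0 <= mean_bump l N x.
Proof.
by rewrite /mean_bump mulr_ge0 // ?invr_ge0 // sumr_ge0 // => j _; exact: bump_ge0.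
Qed.

Lemma mean_bump_le1 l N x : (0 < N)%N -> mean_bump l N x <= 1.
Proof.
move=> N0; rewrite /mean_bump mulrC ler_pdivrMr ?ltr0n // mul1r.
rewrite -[N in leRHS]card_ord -sumr_const.
by apply: ler_sum => j _; exact: bump_le1.
Qed.

Lemma mean_bump_eq1 l N x : (0 < N)%N -> 0 < l -> `|x| <= l ->
  mean_bump l N x = 1.
Proof.
move=> N0 l0 xl; rewrite /mean_bump (eq_bigr (fun=> 1)); last first.
  move=> j _; rewrite bump_eq1 ?scale_gt0 //.
  exact: le_trans xl (scale_ge _ _ l0).
by rewrite sumr_const card_ord mulVf // pnatr_eq0 -lt0n.
Qed.

Lemma mean_bump_eq0 l N x : 0 < l -> 2 * scale l N < `|x| ->
  mean_bump l N x = 0.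
Proof.
move=> l0 xl; rewrite /mean_bump big1 ?mulr0 // => j _.
rewrite bump_eq0 ?scale_gt0 //; apply: le_lt_trans xl.
rewrite ler_pM2l // /scale ler_pM2l // ler_weXn2l ?ler1n //.
exact: ltnW.
Qed.

Lemma mean_bump_compact l N : 0 < l -> compactly_supported (mean_bump l N).
Proof.
move=> l0; pose L := 2 * scale l N.
have cl : closed [set x : E | `|x| <= L].
  apply: (@closed_comp _ _ (fun x : E => `|x|) [set r | r <= L]).
    by move=> x _; exact: norm_continuous.
  exact: closed_le.
apply: (@subclosed_compact _ _ [set x : E | `|x| <= L]).
- exact: closed_closure.
- apply: bounded_closed_compact => //.
  exists L; split; first exact: num_real.
  by move=> M LM x /= xL; exact: le_trans xL (ltW LM).
- rewrite (closure_id [set x : E | `|x| <= L]).1 //; apply: closure_subset => x /=.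
  move=> fx; rewrite leNgt; apply/negP => xL; move: fx.
  by rewrite mean_bump_eq0 ?eqxx.
Qed.

(** A bound of the difference quotients of [mean_bump l N] at [x] for all steps
up to [l / 2]. *)
Definition mean_slope l N x : R :=
  \sum_(j < N) plateau_lip_cst / (N%:R * scale l j) * (shell (scale l j) x)%:R.

Lemma mean_bump_diff l N x h k : 0 < l -> 0 <= h <= l / 2 ->
  `|mean_bump l N (x + h *: unit_vec k) - mean_bump l N x| <= h * mean_slope l N x.
Proof.
move=> l0 /andP[h0 hl]; rewrite /mean_bump -mulrBr normrM -sumrB.
rewrite ger0_norm ?invr_ge0 //.
apply: (@le_trans _ _ (N%:R^-1 * \sum_(j < N)
    h * (plateau_lip_cst / scale l j) * (shell (scale l j) x)%:R)).
  rewrite ler_wpM2l ?invr_ge0 //; apply: le_trans (ler_norm_sum _ _ _) _.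
  apply: ler_sum => j _; apply: bump_diff; first exact: scale_gt0.
  by rewrite h0 /=; have := scale_ge l j l0; lra.
rewrite /mean_slope !mulr_sumr; apply: ler_sum => j _.
rewrite (invfM N%:R (scale l j)); move: (N%:R^-1) (scale l j)^-1 => a b.
by rewrite le_eqVlt; apply/orP; left; apply/eqP; ring.
Qed.

Lemma powR_sum_disjoint N (b : 'I_N -> R) (s : 'I_N -> bool) (p : R) : 0 < p ->
  (forall j, 0 <= b j) -> (forall i j : 'I_N, (i < j)%N -> s i -> s j -> False) ->
  (\sum_j b j * (s j)%:R) `^ p <= \sum_j b j `^ p * (s j)%:R.
Proof.
move=> p0 b0 dis.
have [/existsP[j sj]|] := boolP [exists j, s j].
  rewrite (bigD1 j) //= big1 ?addr0; last first.
    move=> i ij; have [si|] := boolP (s i); last by rewrite mulr0.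
    have [H|H|H] := ltngtP i j; [case: (dis i j)|case: (dis j i)|] => //.
    by move: ij; rewrite (ord_inj H) eqxx.
  rewrite (bigD1 j) //= sj !mulr1 lerDl sumr_ge0 // => i _.
  by rewrite mulr_ge0 // powR_ge0.
rewrite negb_exists => /forallP ns.
rewrite big1; last by move=> j _; rewrite (negbTE (ns j)) mulr0.
rewrite powR0 ?gt_eqF // sumr_ge0 // => j _.
by rewrite mulr_ge0 // powR_ge0.
Qed.

Lemma mean_slope_ge0 l N x : 0 < l -> 0 <= mean_slope l N x.
Proof.
move=> l0; apply: sumr_ge0 => j _; rewrite mulr_ge0 // divr_ge0 //.
  exact: ltW (@plateau_lip_cst_gt0 R).
by rewrite mulr_ge0 // ltW // scale_gt0.
Qed.

Lemma mean_slope_powR l N x p : 0 < l -> 0 < p ->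
  mean_slope l N x `^ p <=
  \sum_(j < N) (plateau_lip_cst / (N%:R * scale l j)) `^ p *
     (`|x + 0| <= 3 * scale l j)%R%:R.
Proof.
move=> l0 p0; have b0 (j : 'I_N) : 0 <= plateau_lip_cst / (N%:R * scale l j).
  rewrite divr_ge0 //; first exact: ltW (@plateau_lip_cst_gt0 R).
  by rewrite mulr_ge0 // ltW // scale_gt0.
have dis (i j : 'I_N) (ij : (i < j)%N) := shell_disjoint l x i j l0 ij.
apply: le_trans (powR_sum_disjoint N _ _ p p0 b0 dis) _.
apply: ler_sum => j _; rewrite ler_wpM2l ?powR_ge0 // addr0 ler_nat.
by rewrite /shell; case: (_ <= _).
Qed.

End bump.

(** * Bounds of the capacities of a compact set *)

Section cap_bounds.
Context {R : realType} {n : nat}.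
Local Notation E := 'rV[R]_n.
Implicit Types (x : E) (k : 'I_n) (l p : R) (N : nat).
Local Notation M := (@plateau_lip_cst R).

(** A bound of the L^p norm of [mean_slope]: on the j-th shell the slope is
M / (N l_j), and the shell lies in a box of side 6 l_j, where l_j = l 8^j. *)
Definition slope_norm p l N : R :=
  (\sum_(j < N) (M / (N%:R * scale l j)) `^ p * (2 * (3 * scale l j)) ^+ n) `^ p^-1.

(** A bound of the L^p norm of the differences of [mean_bump], which are at most 1
and vanish outside two boxes of side 4 l 8^N. *)
Definition size_norm p l N : R :=
  (2 * (2 * (2 * scale l N)) ^+ n) `^ p^-1.

Lemma derive_mean_bump_le l N x k : 0 < l ->
  `|'D_(unit_vec k) (mean_bump l N) x| <= mean_slope l N x.
Proof.
move=> l0; have df := (mean_bump_smooth l N [::]).2 k x.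
rewrite /= in df.
have cv : h^-1 *: (mean_bump l N (h *: unit_vec k + x) - mean_bump l N x)
    @[h --> (0 : R)^'+] --> 'D_(unit_vec k) (mean_bump l N) x.
  exact: (cvg_dnbhs_at_right df).
apply: (@cvgr_to_le _ _ _ _ _ _ _ (cvg_norm cv)).
near=> h.
have h0 : 0 < h by near: h; exact: nbhs_right_gt.
have hl : h <= l / 2.
  by near: h; apply: nbhs_right_le; rewrite divr_gt0.
rewrite normrM normfV (gtr0_norm h0) mulrC ler_pdivrMr // mulrC.
by rewrite [h *: _ + x]addrC; apply: mean_bump_diff; rewrite // ltW.
Unshelve. all: by end_near. Qed.

Lemma Lp_norm_slope_le l p N (g : E -> R) h : 0 < p -> 0 < l -> 0 <= h ->
  (forall x, `|g x| <= h * mean_slope l N x) ->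
  (Lp_norm p g <= (h * slope_norm p l N)%:E)%E.
Proof.
move=> p0 l0 h0 H.
have s0 (j : 'I_N) := scale_gt0 l j l0.
pose c (j : 'I_N) : R := (M / (N%:R * scale l j)) `^ p.
have -> : h * slope_norm p l N =
    (\sum_(j < N) (h `^ p * c j) * (2 * (3 * scale l j)) ^+ n) `^ p^-1.
  under eq_bigr do rewrite -mulrA.
  rewrite -mulr_sumr powRM ?powR_ge0 //; last first.
    apply: sumr_ge0 => j _; rewrite mulr_ge0 ?powR_ge0 // exprn_ge0 //.
    by rewrite !mulr_ge0 // ltW.
  by rewrite -powRrM divff ?gt_eqF // powRr1.
apply: (@Lp_norm_le_boxes R n p g N (fun j => h `^ p * c j)
  (fun j => 3 * scale l j) (fun=> 0)) => //.
- by move=> j; rewrite mulr_ge0 // powR_ge0.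
- by move=> j; rewrite mulr_ge0 // ltW.
move=> x; apply: (@le_trans _ _ ((h * mean_slope l N x) `^ p)).
  by apply: ge0_ler_powR; rewrite ?nnegrE ?(ltW p0) // mulr_ge0 // mean_slope_ge0.
rewrite powRM ?mean_slope_ge0 //.
under eq_bigr do rewrite -mulrA.
by rewrite -mulr_sumr ler_wpM2l ?powR_ge0 // mean_slope_powR.
Qed.

Lemma Lp_norm_diff_le l p N k h : 0 < p -> 0 < l -> (0 < N)%N ->
  (Lp_norm p (fun x => mean_bump l N (x + h *: unit_vec k) - mean_bump l N x)%R
    <= (size_norm p l N)%:E)%E.
Proof.
move=> p0 l0 N0; have s0 := scale_gt0 l N l0.
pose a (j : 'I_2) : E := if j == ord0 then 0 else h *: unit_vec k.
have -> : size_norm p l N = (\sum_(j < 2) 1 * (2 * (2 * scale l N)) ^+ n) `^ p^-1.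
  by rewrite /size_norm !big_ord_recl big_ord0 mul1r addr0; congr (_ `^ _); ring.
apply: (@Lp_norm_le_boxes R n p _ 2 (fun=> 1) (fun=> 2 * scale l N) a) => //.
  by move=> _; rewrite mulr_ge0 // ltW.
move=> x; rewrite big_ord_recl big_ord1 !mul1r /a /= addr0.
have f0 := @mean_bump_ge0 R n l N; have f1 := @mean_bump_le1 R n l N ^~ N0.
have d1 : `|mean_bump l N (x + h *: unit_vec k) - mean_bump l N x| <= 1.
  move: (f0 x) (f1 x) (f0 (x + h *: unit_vec k)) (f1 (x + h *: unit_vec k)).
  move: (mean_bump l N (x + _)) (mean_bump l N x) => u v v0 v1 u0 u1.
  by rewrite ler_norml; apply/andP; split; lra.
have d2 : `|mean_bump l N (x + h *: unit_vec k) - mean_bump l N x| `^ p <= 1.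
  by have := ge0_ler_powR (ltW p0) (normr_ge0 _) ler01 d1; rewrite powR1.
case: (leP `|x| (2 * scale l N)) => xL /=.
  by apply: le_trans d2 _; rewrite lerDl.
case: (leP `|x + h *: unit_vec k| (2 * scale l N)) => yL /=; first by rewrite add0r.
by rewrite !mean_bump_eq0 // subrr normr0 powR0 ?gt_eqF // addr0.
Qed.

Lemma modulus_small l p N k t : 0 < p -> 0 < l -> 0 < t <= l / 2 ->
  (modulus k (mean_bump l N) t p <= (slope_norm p l N * t)%:E)%E.
Proof.
move=> p0 l0 /andP[t0 tl]; apply: modulus_le => h /andP[h0 ht].
apply: (@le_trans _ _ (h * slope_norm p l N)%:E); last first.
  by rewrite lee_fin mulrC ler_wpM2l // powR_ge0.
apply: Lp_norm_slope_le => // x; apply: mean_bump_diff => //.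
by rewrite h0 (le_trans ht).
Qed.

Lemma mean_bump_admissible l N (K : set E) : (0 < N)%N -> 0 < l ->
  (forall x, K x -> `|x| <= l) -> admissible K (mean_bump l N).
Proof.
move=> N0 l0 Kl; split; first exact: mean_bump_smooth.
  exact: mean_bump_compact.
by move=> x Kx; rewrite mean_bump_eq1 // Kl.
Qed.

Lemma sum_cst_le (F : 'I_n -> \bar R) (a : R) :
  (forall k, (F k <= a%:E)%E) -> (\sum_(k < n) F k <= (n%:R * a)%:E)%E.
Proof.
move=> H; apply: (@le_trans _ _ (\sum_(k < n) a%:E)%E); first exact: lee_sum.
rewrite sumEFin sumr_const card_ord mulr_natl lexx //.
Qed.

Lemma capW_compact_le l p N (K : set E) : 0 < p -> 0 < l -> (0 < N)%N ->
  (forall x, K x -> `|x| <= l) ->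
  (capW_compact p K <= ((n%:R * slope_norm p l N) `^ p)%:E)%E.
Proof.
move=> p0 l0 N0 Kl; apply: ge_ereal_inf.
exists ((\sum_(k < n) Lp_norm p ('D_(unit_vec k) (mean_bump l N))) `^ p)%E.
  by exists (mean_bump l N) => //; exact: mean_bump_admissible.
rewrite -poweR_EFin; apply: ge0_le_poweR; first exact: ltW.
  by apply: sume_ge0 => k _; exact: Lnorm_ge0.
apply: sum_cst_le => k; rewrite -[slope_norm _ _ _]mul1r.
by apply: Lp_norm_slope_le => // x; rewrite mul1r; exact: derive_mean_bump_le.
Qed.

Lemma capB_compact_le l p q alpha d N (K : set E) :
  0 < p -> 0 < q -> 0 < alpha < 1 -> 0 < l -> 0 < d <= l / 2 -> (0 < N)%N ->
  (forall x, K x -> `|x| <= l) ->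
  (capB_compact alpha p q K <= ((n%:R *
    (slope_norm p l N `^ q * (d `^ (q * (1 - alpha)) / (q * (1 - alpha))) +
     size_norm p l N `^ q * (d `^ (- (alpha * q)) / (alpha * q))) `^ q^-1) `^ p)%:E)%E.
Proof.
move=> p0 q0 al l0 /andP[d0 dl] N0 Kl; apply: ge_ereal_inf.
exists (besov alpha p q (mean_bump l N : E -> R) `^ p)%E.
  by exists (mean_bump l N) => //; exact: mean_bump_admissible.
rewrite -poweR_EFin; apply: ge0_le_poweR; first exact: ltW.
  by apply: sume_ge0 => k _; exact: poweR_ge0.
apply: sum_cst_le => k; apply: besov_partial_le => //; rewrite ?powR_ge0 //.
  move=> t /andP[t0 td]; apply: modulus_small => //.
  by rewrite t0 (le_trans td).
by move=> t _; apply: modulus_le => h _; exact: Lp_norm_diff_le.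
Qed.

End cap_bounds.

(** * Decay of the bounds *)

Section asymptotics.
Context {R : realType}.

Lemma powR_decay (C g eps : R) (m0 : nat) : 0 <= C -> 0 < g -> 0 < eps ->
  exists2 m : nat, (maxn m0 1 <= m)%N & C * m%:R `^ (- g) <= eps.
Proof.
move=> C0 g0 e0; pose r := (C / eps) `^ g^-1.
exists (maxn (maxn m0 1) (Num.truncn r).+1); first exact: leq_maxl.
set m := maxn _ _.
have m_gt0 : (0 : R) < m%:R by rewrite ltr0n /m; lia.
have rm : r <= m%:R.
  by apply: ltW; apply: (lt_le_trans (truncnS_gt _)); rewrite ler_nat leq_maxr.
rewrite powRN ler_pdivrMr ?powR_gt0 // mulrC -ler_pdivrMr //.
have := @ge0_ler_powR R g (ltW g0) r m%:R (powR_ge0 _ _) (ltW m_gt0) rm.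
by rewrite /r -powRrM mulVf ?gt_eqF // powRr1 // divr_ge0 // ltW.
Qed.

Lemma ereal_eq0_decay (x : \bar R) (C g : R) (m0 : nat) : (0 <= x)%E ->
  0 <= C -> 0 < g ->
  (forall m : nat, (maxn m0 1 <= m)%N -> (x <= (C * m%:R `^ (- g))%:E)%E) ->
  x = 0%E.
Proof.
move=> x0 C0 g0 H; apply/eqP; rewrite eq_le x0 andbT.
apply/lee_addgt0Pr => eps e0; rewrite add0e.
have [m mm Cm] := powR_decay C g eps m0 C0 g0 e0.
by apply: le_trans (H m mm) _; rewrite lee_fin.
Qed.

Lemma cvge_to0 {T : Type} (F : set_system T) {FF : Filter F} (f : T -> \bar R) :
  (forall x, (0 <= f x)%E) ->
  (forall eps : R, 0 < eps -> \forall x \near F, (f x <= eps%:E)%E) ->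
  f @ F --> (0%E : \bar R).
Proof.
move=> f0 H; apply/fine_cvgP; split.
  apply: filterS (H 1 ltr01) => x fx.
  by rewrite ge0_fin_numE // (le_lt_trans fx) // ltry.
apply/cvgr0Pnorm_le => eps e0; apply: filterS (H eps e0) => x fx /=.
rewrite ger0_norm ?fine_ge0 // -lee_fin fineK //.
by rewrite ge0_fin_numE // (le_lt_trans fx) // ltry.
Qed.

Lemma powR_scaleM (c l a b : R) : 0 <= c ->
  (c * l `^ a) `^ b = c `^ b * l `^ (a * b).
Proof. by move=> c0; rewrite powRM ?powR_ge0 // powRrM. Qed.

Context {n : nat}.
Implicit Types (l p : R) (N : nat).
Local Notation M := (@plateau_lip_cst R).
Local Notation snorm := (@slope_norm R n).
Local Notation znorm := (@size_norm R n).

Lemma scale_powR_root (c l p : R) : 0 <= c -> 0 <= l -> p != 0 ->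
  ((c * l) ^+ n) `^ p^-1 = (c ^+ n) `^ p^-1 * l `^ (n%:R / p).
Proof.
move=> c0 l0 p0; rewrite exprMn powRM ?exprn_ge0 //; congr (_ * _).
by rewrite -powR_mulrn // -powRrM.
Qed.

Lemma slope_norm1 p l : 0 < p -> 0 < l ->
  snorm p l 1 = (M * (6 ^+ n) `^ p^-1) * l `^ (n%:R / p - 1).
Proof.
move=> p0 l0; rewrite /slope_norm big_ord1 /scale expr0 mulr1 mul1r.
have M0 := ltW (@plateau_lip_cst_gt0 R).
have Ml0 : 0 <= M / l by rewrite divr_ge0 // ltW.
have -> : 2 * (3 * l) = 6 * l by ring.
rewrite powRM ?powR_ge0 ?exprn_ge0 ?mulr_ge0 ?(ltW l0) //.
rewrite -powRrM divff ?gt_eqF // powRr1 // scale_powR_root ?(ltW l0) ?gt_eqF //.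
have -> : l `^ (n%:R / p - 1) = l `^ (n%:R / p) / l.
  by rewrite powRB ?(gt_eqF l0) ?implybT // powRr1 // ltW.
by move: (l^-1) => z; ring.
Qed.

Lemma size_norm1 p l : 0 < p -> 0 < l ->
  znorm p l 1 = (2 `^ p^-1 * (32 ^+ n) `^ p^-1) * l `^ (n%:R / p).
Proof.
move=> p0 l0; rewrite /size_norm /scale expr1.
have -> : 2 * (2 * (l * 8)) = 32 * l by ring.
rewrite powRM ?exprn_ge0 ?mulr_ge0 ?(ltW l0) //.
by rewrite scale_powR_root ?(ltW l0) ?gt_eqF // mulrA.
Qed.

(** For p = n the contributions of all scales are equal, and the [N] terms of size
N^-n leave a factor N^(1-n). *)
Lemma slope_norm_crit l N : (0 < n)%N -> (0 < N)%N -> 0 < l ->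
  snorm n%:R l N `^ n%:R = (6 * M) ^+ n * N%:R `^ (- (n.-1)%:R).
Proof.
move=> n0 N0 l0; have M0 := ltW (@plateau_lip_cst_gt0 R).
have nn0 : n%:R != 0 :> R by rewrite pnatr_eq0 -lt0n.
have NN0 : N%:R != 0 :> R by rewrite pnatr_eq0 -lt0n.
rewrite /slope_norm (eq_bigr (fun=> (6 * M / N%:R) ^+ n)); last first.
  move=> j _; have s0 := scale_gt0 l j l0.
  rewrite powR_mulrn; last by rewrite divr_ge0 // mulr_ge0 // ltW.
  rewrite -exprMn; congr (_ ^+ _).
  by move: (scale l j) s0 => s s0; field; rewrite NN0 gt_eqF.
rewrite sumr_const card_ord -powRrM mulVf // powRr1; last first.
  by rewrite mulrn_wge0 // exprn_ge0 // divr_ge0 // mulr_ge0.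
rewrite -[LHS]mulr_natr exprMn -mulrA; congr (_ * _).
rewrite powRN powR_mulrn // exprVn -[in LHS](prednK n0) exprS invfM.
by rewrite mulrAC mulVf // mul1r.
Qed.

End asymptotics.

(** * Vanishing of the capacities *)

Section capacities_vanish.
Context {R : realType} {n : nat}.
Local Notation E := 'rV[R]_n.
Local Notation M := (@plateau_lip_cst R).
Implicit Types (K G : set E) (p q alpha : R).

Lemma capW_compact_ge0 p K : (0 <= capW_compact p K)%E.
Proof. by apply: le_ereal_inf_tmp => _ [f _ <-]; exact: poweR_ge0. Qed.

Lemma capB_compact_ge0 alpha p q K : (0 <= capB_compact alpha p q K)%E.
Proof. by apply: le_ereal_inf_tmp => _ [f _ <-]; exact: poweR_ge0. Qed.

Lemma cap_open_ge0 (cap : set E -> \bar R) G :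
  (forall K, (0 <= cap K)%E) -> (0 <= cap_open cap G)%E.
Proof.
move=> cap0; apply: le_trans (cap0 set0) _.
apply: ereal_sup_ubound; exists set0 => //; split; first exact: compact0.
exact: sub0set.
Qed.

Lemma cap_open_le (cap : set E -> \bar R) G (C : \bar R) :
  (forall K, compact K -> K `<=` G -> (cap K <= C)%E) -> (cap_open cap G <= C)%E.
Proof. by move=> H; apply: ge_ereal_sup => _ [K [cK KG] <-]; exact: H. Qed.

Lemma cap_open_eq0 (cap : set E -> \bar R) G :
  (forall K, (0 <= cap K)%E) -> (forall K, compact K -> cap K = 0%E) ->
  cap_open cap G = 0%E.
Proof.
move=> cap0 H; apply/eqP; rewrite eq_le cap_open_ge0 // andbT.
by apply: cap_open_le => K cK _; rewrite H.
Qed.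

Lemma bounded_set_nat (A : set E) : bounded_set A ->
  exists m0 : nat, forall m, (m0 <= m)%N -> forall x, A x -> `|x| <= m%:R.
Proof.
move=> [r [_ Ar]]; exists (Num.truncn r).+1 => m rm x Ax.
by apply: Ar => //; apply: (lt_le_trans (truncnS_gt _)); rewrite ler_nat.
Qed.

Lemma capW_compact_eq0 p K : n%:R < p -> compact K -> capW_compact p K = 0%E.
Proof.
move=> np /compact_bounded/bounded_set_nat[m0 Km].
have p0 : 0 < p by apply: le_lt_trans np.
have M0 := ltW (@plateau_lip_cst_gt0 R).
have c0 : 0 <= n%:R * (M * (6 ^+ n) `^ p^-1).
  by rewrite mulr_ge0 // mulr_ge0 // powR_ge0.
apply: (@ereal_eq0_decay R _ ((n%:R * (M * (6 ^+ n) `^ p^-1)) `^ p) (p - n%:R) m0).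
- exact: capW_compact_ge0.
- exact: powR_ge0.
- by rewrite subr_gt0.
move=> m; rewrite geq_max => /andP[mm m1].
have l0 : (0 : R) < m%:R by rewrite ltr0n.
apply: le_trans (@capW_compact_le R n m%:R p 1 K p0 l0 isT (Km m mm)) _.
rewrite lee_fin slope_norm1 // mulrA powR_scaleM //.
suff -> : (n%:R / p - 1) * p = - (p - n%:R) by [].
by rewrite mulrBl divfK ?gt_eqF // mul1r opprB.
Qed.

Lemma sum_two_scales (a b c d x y z w s t u : R) : u = x * y -> u = z * w ->
  a * x * (b * y * s) + c * z * (d * w * t) = (a * (b * s) + c * (d * t)) * u.
Proof.
move=> uxy uzw; rewrite [RHS]mulrDl {1}uxy uzw.
by ring.
Qed.

Lemma capB_compact_eq0 p q alpha K : n%:R < p -> 0 < q -> n%:R / p < alpha < 1 ->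
  compact K -> capB_compact alpha p q K = 0%E.
Proof.
move=> np q0 /andP[nal al1] /compact_bounded/bounded_set_nat[m0 Km].
have p0 : 0 < p by apply: le_lt_trans np.
have al0 : 0 < alpha by apply: le_lt_trans nal; rewrite divr_ge0 // ltW.
have M0 := ltW (@plateau_lip_cst_gt0 R).
pose c1 : R := M * (6 ^+ n) `^ p^-1.
pose c2 : R := 2 `^ p^-1 * (32 ^+ n) `^ p^-1.
pose s := q * (1 - alpha); pose t := alpha * q.
have s0 : 0 < s by rewrite mulr_gt0 // subr_gt0.
have t0 : 0 < t by rewrite mulr_gt0.
pose c : R := c1 `^ q * (2^-1 `^ s / s) + c2 `^ q * (2^-1 `^ (- t) / t).
have c10 : 0 <= c1 by rewrite mulr_ge0 ?powR_ge0.
have c20 : 0 <= c2 by rewrite mulr_ge0 ?powR_ge0.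
have c0 : 0 <= c.
  by rewrite addr_ge0 // mulr_ge0 ?powR_ge0 // divr_ge0 ?powR_ge0 // ltW.
pose e := n%:R / p.
apply: (@ereal_eq0_decay R _ ((n%:R * c `^ q^-1) `^ p) ((alpha - e) * p) m0).
- exact: capB_compact_ge0.
- exact: powR_ge0.
- by rewrite mulr_gt0 // subr_gt0.
move=> m; rewrite geq_max => /andP[mm m1].
have l0 : (0 : R) < m%:R by rewrite ltr0n.
have l00 := ltW l0.
have ln0 : (m%:R : R) != 0 by rewrite gt_eqF.
have d0 : 0 < 2^-1 * (m%:R : R) <= (m%:R : R) / 2.
  by rewrite [2^-1 * _]mulrC lexx andbT divr_gt0.
have al01 : 0 < alpha < 1 by rewrite al0.
apply: le_trans (@capB_compact_le R n m%:R p q alpha (2^-1 * m%:R) 1 K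
   p0 q0 al01 l0 d0 isT (Km m mm)) _.
rewrite lee_fin slope_norm1 // size_norm1 // -/c1 -/c2 -/s -/t -/e.
have -> : (c1 * m%:R `^ (e - 1)) `^ q * ((2^-1 * m%:R) `^ s / s) +
    (c2 * m%:R `^ e) `^ q * ((2^-1 * m%:R) `^ (- t) / t) =
    c * m%:R `^ ((e - alpha) * q).
  rewrite (powR_scaleM c1) // (powR_scaleM c2) // !(powRM _ _ l00) ?invr_ge0 //.
  have X1 : m%:R `^ ((e - alpha) * q) = m%:R `^ ((e - 1) * q) * m%:R `^ s :> R.
    by rewrite -powRD ?ln0 ?implybT //; congr (_ `^ _); rewrite /s; ring.
  have X2 : m%:R `^ ((e - alpha) * q) = m%:R `^ (e * q) * m%:R `^ (- t) :> R.
    by rewrite -powRD ?ln0 ?implybT //; congr (_ `^ _); rewrite /t; ring.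
  exact: sum_two_scales X1 X2.
rewrite (powR_scaleM c) // mulrA (powR_scaleM (_ * _)); last first.
  by rewrite mulr_ge0 ?powR_ge0.
suff -> : (e - alpha) * q * q^-1 * p = - ((alpha - e) * p) by [].
by rewrite mulfK ?gt_eqF //; ring.
Qed.

Lemma capW_bounded_eq0 G : (2 <= n)%N -> bounded_set G -> capW n%:R G = 0%E.
Proof.
move=> n2 /bounded_set_nat[m0 Gm].
have n0 : (0 < n)%N by exact: ltn_trans n2.
have p0 : (0 : R) < n%:R by rewrite ltr0n.
have M0 := ltW (@plateau_lip_cst_gt0 R).
pose l : R := m0.+1%:R.
have l0 : 0 < l by rewrite ltr0n.
apply: (@ereal_eq0_decay R _ (n%:R `^ n%:R * (6 * M) ^+ n) (n.-1)%:R 1).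
- by apply: cap_open_ge0 => K; exact: capW_compact_ge0.
- by rewrite mulr_ge0 ?powR_ge0 // exprn_ge0 // mulr_ge0.
- by rewrite ltr0n -ltnS prednK.
move=> N; rewrite maxnn => N0.
apply: cap_open_le => K _ KG.
have Kl x : K x -> `|x| <= l by move=> /KG; exact: Gm.
apply: le_trans (@capW_compact_le R n l n%:R N K p0 l0 N0 Kl) _.
by rewrite lee_fin powRM ?powR_ge0 // slope_norm_crit // mulrA.
Qed.

Lemma near1_sum_le (a b q alpha : R) : 0 < a -> 0 <= b -> 1 <= q ->
  2^-1 <= alpha -> alpha < 1 -> 1 - alpha <= a / (2 * (b + 1)) ->
  a / q + (1 - alpha) * (b / (alpha * q)) <= 2 * a.
Proof.
move=> a0 b0 q1 al al1 H.
have q0 : 0 < q by lra.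
have al0 : 0 < alpha by lra.
have b1 : 0 < 2 * (b + 1) by lra.
have h0 : a / q <= a.
  by rewrite ler_pdivrMr //; rewrite ler_peMr // ltW.
have aq : 2^-1 <= alpha * q.
  by apply: (le_trans al); rewrite ler_peMr // ltW.
have h1 : b / (alpha * q) <= 2 * (b + 1).
  rewrite ler_pdivrMr ?mulr_gt0 //.
  have := ler_wpM2l (ltW b1) aq; lra.
have h2 : (1 - alpha) * (b / (alpha * q)) <= a.
  rewrite -[leRHS](divfK (lt0r_neq0 b1)); apply: ler_pM => //; first by lra.
  by rewrite divr_ge0 // mulr_ge0 // ltW.
lra.
Qed.

(** The number [N] of scales is first chosen so that (n (2 A^q)^(1/q))^n, a
multiple of N^(1-n), is at most eps; then alpha is taken so close to 1 that the
second term of the Besov bound, multiplied by 1 - alpha, is at most A^q. *)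
Lemma capB_bounded_lim q G : (2 <= n)%N -> 1 <= q -> bounded_set G ->
  (((1 - alpha) `^ (n%:R / q))%:E * capB alpha n%:R q G)%E
     @[alpha --> (1 : R)^'-] --> (0%E : \bar R).
Proof.
move=> n2 q1 /bounded_set_nat[m0 Gm].
have n0 : (0 < n)%N by exact: ltn_trans n2.
have p0 : (0 : R) < n%:R by rewrite ltr0n.
have q0 : 0 < q by exact: lt_le_trans q1.
have M0 := @plateau_lip_cst_gt0 R.
(* l >= 2 allows the split point d = 1, whose powers do not depend on alpha. *)
pose l : R := m0.+2%:R.
have l0 : 0 < l by rewrite ltr0n.
have l2 : 1 <= l / 2 by rewrite ler_pdivlMr // mul1r ler_nat.
apply: cvge_to0 => [alpha|eps e0].
  rewrite mule_ge0 ?lee_fin ?powR_ge0 //.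
  by apply: cap_open_ge0 => K; exact: capB_compact_ge0.
pose C : R := (n%:R * 2 `^ q^-1) `^ n%:R * (6 * M) ^+ n.
have C0 : 0 <= C.
  by rewrite mulr_ge0 ?powR_ge0 // exprn_ge0 // mulr_ge0 // ltW.
have g0 : (0 : R) < (n.-1)%:R by rewrite ltr0n -ltnS prednK.
have [N] := @powR_decay R C (n.-1)%:R eps 1 C0 g0 e0.
rewrite maxnn => N0 CN.
pose A := @slope_norm R n n%:R l N; pose B := @size_norm R n n%:R l N.
have A0 : 0 < A.
  have : 0 < A `^ n%:R.
    rewrite slope_norm_crit // mulr_gt0 ?powR_gt0 ?ltr0n //.
    by rewrite exprn_gt0 // mulr_gt0.
  by apply: gt0_powR => //; rewrite powR_ge0.
have An := slope_norm_crit l N n0 N0 l0; rewrite -/A in An.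
have d1 : (0 : R) < 1 <= l / 2 by rewrite ltr01.
have capK alpha K : 0 < alpha < 1 -> K `<=` G ->
    (capB_compact alpha n%:R q K <= ((n%:R *
      (A `^ q * (1 `^ (q * (1 - alpha)) / (q * (1 - alpha))) +
       B `^ q * (1 `^ (- (alpha * q)) / (alpha * q))) `^ q^-1) `^ n%:R)%:E)%E.
  move=> al KG; have Kl x : K x -> `|x| <= l.
    by move=> /KG; apply: Gm; exact: leqW.
  exact: (@capB_compact_le R n l n%:R q alpha 1 N K p0 q0 al l0 d1 N0 Kl).
clearbody A B.
have Aq0 : 0 < A `^ q by rewrite powR_gt0.
have Bq0 : 0 <= B `^ q by exact: powR_ge0.
pose del := A `^ q / (2 * (B `^ q + 1)).
have del0 : 0 < del by rewrite divr_gt0 // mulr_gt0 // ltr_wpDl.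
near=> alpha.
have al1 : alpha < 1 by near: alpha; exact: nbhs_left_lt.
have al2 : 2^-1 <= alpha.
  by near: alpha; apply: nbhs_left_ge; rewrite invf_lt1 // ltr1n.
have ald : 1 - del <= alpha.
  by near: alpha; apply: nbhs_left_ge; rewrite gtrBl.
have al0 : 0 < alpha by apply: lt_le_trans al2; rewrite invr_gt0.
have al01 : 0 < alpha < 1 by rewrite al0.
have b0 : 0 < 1 - alpha by rewrite subr_gt0.
pose S := A `^ q * (1 `^ (q * (1 - alpha)) / (q * (1 - alpha))) +
     B `^ q * (1 `^ (- (alpha * q)) / (alpha * q)).
have S0 : 0 <= S.
  by rewrite addr_ge0 // mulr_ge0 ?powR_ge0 // divr_ge0 ?powR_ge0 // mulr_ge0 // ltW.
apply: (@le_trans _ _ (((1 - alpha) `^ (n%:R / q))%:E *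
    ((n%:R * S `^ q^-1) `^ n%:R)%:E)%E).
  rewrite lee_wpmul2l ?lee_fin ?powR_ge0 //.
  by apply: cap_open_le => K _ KG; exact: capK.
rewrite -EFinM lee_fin; apply: le_trans CN.
have -> : (1 - alpha) `^ (n%:R / q) * (n%:R * S `^ q^-1) `^ n%:R =
    (n%:R * ((1 - alpha) * S) `^ q^-1) `^ n%:R.
  rewrite (powRM _ (ltW b0) S0) mulrCA [in RHS]powRM ?powR_ge0 //; last first.
    by rewrite mulr_ge0 // powR_ge0.
  by rewrite -[in RHS]powRrM [q^-1 * _]mulrC.
rewrite /C -mulrA -An -powRM ?mulr_ge0 ?powR_ge0 ?(ltW A0) //.
apply: ge0_ler_powR; rewrite ?nnegrE ?mulr_ge0 ?powR_ge0 ?(ltW A0) ?(ltW p0) //.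
rewrite -mulrA ler_wpM2l //.
have -> : 2 `^ q^-1 * A = (2 * A `^ q) `^ q^-1.
  by rewrite powRM ?powR_ge0 // -powRrM divff ?gt_eqF // powRr1 // ltW.
apply: ge0_ler_powR;
  rewrite ?nnegrE ?mulr_ge0 ?powR_ge0 ?invr_ge0 ?(ltW q0) ?(ltW b0) //.
have -> : (1 - alpha) * S = A `^ q / q + (1 - alpha) * (B `^ q / (alpha * q)).
  rewrite /S !powR1; move: (A `^ q) (B `^ q) => a b; field.
  by rewrite !gt_eqF.
have h : 1 - alpha <= del by move: ald; rewrite lerBlDr -lerBlDl.
exact: (near1_sum_le _ _ q alpha Aq0 Bq0 q1 al2 al1 h).
Unshelve. all: by end_near. Qed.

End capacities_vanish.

Theorem mainTheorem5 (R : realType) (n : nat) (q : R) (n_gt0 : (0 < n)%N)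
    (q_ge1 : 1 <= q) :
  [/\ forall p : R, n%:R < p -> forall G : set 'rV[R]_n, open G ->
        capW p G = 0%E /\
        forall alpha : R, n%:R / p < alpha < 1 -> capB alpha p q G = 0%E,
      (2 <= n)%N -> forall G : set 'rV[R]_n, open G -> bounded_set G ->
        capW n%:R G = 0%E /\
        (((1 - alpha) `^ (n%:R / q))%:E * capB alpha n%:R q G)%E
          @[alpha --> (1 : R)^'-] --> (0%E : \bar R)
    & forall p : R, n%:R < p \/ (p = n%:R /\ (2 <= n)%N) ->
        forall G : set 'rV[R]_n, open G -> bounded_set G ->
        (((1 - alpha) `^ (p / q))%:E * capB alpha p q G)%E
          @[alpha --> (1 : R)^'-] --> (0%E : \bar R) /\
        (((1 / q) `^ (p / q))%:E * capW p G)%E = 0%E ].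
Proof.
have q0 : 0 < q by exact: lt_le_trans q_ge1.
(* The case p > n, shared by the first and the third assertion. *)
have super p (G : set 'rV[R]_n) : n%:R < p -> capW p G = 0%E /\
    forall alpha : R, n%:R / p < alpha < 1 -> capB alpha p q G = 0%E.
  move=> np; split=> [|alpha al]; apply: cap_open_eq0 => K.
  - exact: capW_compact_ge0.
  - exact: capW_compact_eq0.
  - exact: capB_compact_ge0.
  - exact: capB_compact_eq0.
split=> [p np G _|n2 G _ bG|p [np|[-> n2]] G _ bG].
- exact: super.
- by split; [exact: capW_bounded_eq0|exact: capB_bounded_lim].
- have [-> B0] := super p G np; rewrite mule0; split=> //.
  apply: cvge_to0 => [alpha|eps e0].
    rewrite mule_ge0 ?lee_fin ?powR_ge0 //.
    by apply: cap_open_ge0 => K; exact: capB_compact_ge0.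
  near=> alpha; rewrite B0 ?mule0 ?lee_fin ?(ltW e0) //.
  apply/andP; split; near: alpha; last exact: nbhs_left_lt.
  apply: nbhs_left_gt; rewrite ltr_pdivrMr ?mul1r //.
  exact: le_lt_trans np.
- by rewrite capW_bounded_eq0 // mule0; split=> //; exact: capB_bounded_lim.
Unshelve. all: by end_near. Qed.
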